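(* Let $X$ be a finite dimensional real Banach space with $\dim X=n\ge 1$. Then for any Auerbach basis $\{(x_k,x_k^* ):1\le k\le n\}$ of $X$ there exist $n+1$ linear combinations $z_1,\dots,z_{n+1}$ of the vectors $x_1,\dots,x_n$, all of whose coefficients belong to $\{0,1,-1\}$, such that $\|z_k\|=1$ for $1\le k\le n+1$ and $\|z_k-z_l\|>1$ for $1\le k<l\le n+1$.
   Context: An Auerbach basis of an $n$-dimensional Banach space $X$ is a family of pairs $\{(x_k,x_k^* ):1\le k\le n\}\subseteq X\times X^*$ such that $x_i^*(x_j)=\delta_{ij}$ for all $i,j$ and $\|x_k\|=\|x_k^*\|=1$ for all $k$. *)

(* Defs.v *)
From HB Require Import structures.
From mathcomp Require Import all_boot all_order all_algebra.
From mathcomp Require Import all_classical all_reals all_analysis.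

Set Implicit Arguments.
Unset Strict Implicit.
Unset Printing Implicit Defensive.

Import Order.TTheory GRing.Theory Num.Theory.
Import numFieldNormedType.Exports.

Local Open Scope classical_set_scope.
Local Open Scope ring_scope.

#[short(type="finDimBanachType")]
HB.structure Definition FinDimBanach (R : realType) :=
  {X of CompleteNormedModule R X & Vector R X}.

(* The set below is bounded when f is linear and continuous; on unbounded
   functionals sup takes a junk value. *)
Definition dual_norm (R : realType) (X : normedModType R) (f : X -> R) : R :=
  sup [set `|f x| | x in [set x : X | `|x| <= 1]].

(* Continuity is what places the linear forms f k in the topological dual. *)
Definition Auerbach_basis (R : realType) (X : finDimBanachType R) (n : nat)
    (x : 'I_n -> X) (f : 'I_n -> {scalar X}) : Prop :=
  [/\ \dim {:X} = n,
      forall k, continuous (f k : X -> R),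
      forall i j, f i (x j) = (i == j)%:R,
      forall k, `|x k| = 1
    & forall k, dual_norm (f k) = 1].

(* Main.v *)
(* Let A be the set of combinations of the x_k with coefficients in {0, 1, -1}
   and norm 1. Since |f_i v| <= |v|, a nonzero vector with integer coordinates
   has norm at least 1, and norm exactly 1 only if it lies in A. So it suffices
   to find n+1 distinct elements of A whose pairwise differences are not in A.
   As for root systems, fix a linear form phi without zeros on A, here
   phi = \sum_i 3^i f_i, and call an element of A positive if phi is positive
   there. If u and v are positive and neither is a sum of two positive elements,
   then u - v is not in A, since otherwise u = v + (u - v) or v = u + (v - u)
   would be such a sum. These indecomposable elements span X, so there are at
   least n of them. Finally, if t maximizes phi on A, then -t can be added:
   -t - v in A would give t + v in A, beyond the maximum. *)
From HB Require Import structures.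
Require Import Defs.
From mathcomp Require Import all_boot all_order all_algebra.
From mathcomp Require Import all_classical all_reals all_analysis.
From mathcomp Require Import lra.
Import Order.TTheory GRing.Theory Num.Theory.
Import numFieldNormedType.Exports.
Local Open Scope classical_set_scope.
Local Open Scope ring_scope.

Set Implicit Arguments.
Unset Strict Implicit.

(** Twice 1 + 3 + ... + 3^(n-1) equals 3^n - 1, so a top term of size 3^n outweighs all lower
    ones. *)
Lemma ternary_sum_bound (R : realFieldType) (n : nat) (c : nat -> R) :
  (forall i, (i < n)%N -> `|c i| <= 1) ->
  `|\sum_(i < n) 3 ^+ i * c i| *+ 2 < 3 ^+ n.
Proof.
elim: n => [|n IHn] c1; first by rewrite big_ord0 normr0 mul0rn ltr01.
rewrite big_ord_recr /=.
have /IHn IH : forall i, (i < n)%N -> `|c i| <= 1 by move=> i /ltnW; exact: c1.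
have p0 : 0 < 3 ^+ n :> R by rewrite exprn_gt0.
have := ler_normD (\sum_(i < n) 3 ^+ i * c i) (3 ^+ n * c n).
have : `|3 ^+ n * c n| <= 3 ^+ n.
  by rewrite normrM gtr0_norm// ler_piMr ?c1// ltW.
by rewrite exprS; lra.
Qed.

(** A leading digit 1 or -1 could not be cancelled by the lower terms, so it is 0 and induction
    applies. This is why [phi] has no zeros on [A] in the main proof. *)
Lemma ternary_sum_eq0 (R : realFieldType) (n : nat) (c : nat -> R) :
  (forall i, (i < n)%N -> c i \in [:: 0; 1; -1]) ->
  \sum_(i < n) 3 ^+ i * c i = 0 -> forall i, (i < n)%N -> c i = 0.
Proof.
elim: n => [//|n IHn] c1.
have cn i : (i < n)%N -> c i \in [:: 0; 1; -1] by move=> /ltnW; exact: c1.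
have := @ternary_sum_bound R n c; rewrite big_ord_recr /= => bound.
have {}bound : `|\sum_(i < n) 3 ^+ i * c i| *+ 2 < 3 ^+ n.
  apply: bound => i /cn; rewrite !inE => /or3P[] /eqP ->;
  by rewrite ?normr0 ?normrN ?normr1.
have p0 : 0 < 3 ^+ n :> R by rewrite exprn_gt0.
move: (c1 n (ltnSn n)); rewrite !inE => /or3P[] /eqP cn0.
- rewrite cn0 mulr0 addr0 => s0 i; rewrite ltnS leq_eqVlt => /orP[/eqP->//|].
  exact: IHn.
- rewrite cn0 mulr1 => /eqP; rewrite addr_eq0 => /eqP s0.
  by move: bound; rewrite s0 normrN gtr0_norm//; lra.
- rewrite cn0 mulrN1 => /eqP; rewrite subr_eq0 => /eqP s0.
  by move: bound; rewrite s0 gtr0_norm//; lra.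
Qed.

(** The combinatorial core, modelled on simple roots: [A] stands for the norm-one combinations, and
    [phi] splits it into a positive and a negative half. *)
Lemma exists_difference_free (K : realFieldType) (V : vectType K) (A : seq V)
    (phi : {scalar V}) :
    {in A, forall v, - v \in A} -> {in A, forall v, phi v != 0} ->
    <<A>>%VS = fullv -> (0 < \dim {:V})%N ->
  exists s : seq V, [/\ size s = (\dim {:V}).+1, uniq s, {subset s <= A} &
    {in s &, forall u v, u - v \notin A}].
Proof.
move=> AN phiA spanA dimV.
pose pos := [pred v | (v \in A) && (0 < phi v)].
(* Indecomposability. Since [pos] includes membership in [A], letting v run over [A] covers every
   splitting u = v + (u - v). *)
pose simple := [pred u | pos u && all (fun v => ~~ (pos v && pos (u - v))) A].
pose S := undup [seq u <- A | simple u].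
have inS u : (u \in S) = simple u.
  rewrite mem_undup mem_filter; apply: andb_idr => /andP[/andP[]] //.
have posVN v : v \in A -> pos v \/ pos (- v).
  move=> vA; have := phiA _ vA; rewrite neq_lt /pos /= vA AN// linearN /=.
  by rewrite oppr_gt0 => /orP[]; [right | left].
(* Descent on [phi]: a positive element outside the span with least [phi] is not simple, so it
   splits into two positive elements of smaller [phi]. Both lie in the span, hence so does their
   sum. *)
have posS v : pos v -> v \in <<S>>%VS.
  move=> pv; apply: contrapT => /negP vS.
  have vA : v \in A by case/andP: pv.
  pose P := [pred a : seq_sub A | pos (val a) && (val a \notin <<S>>%VS)].
  have Pv : P (SeqSub vA) by apply/andP.
  case: (arg_minP (fun a : seq_sub A => phi (val a)) Pv) => u.
  case/andP=> pu uS umin.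
  have : ~~ all (fun v => ~~ (pos v && pos (val u - v))) A.
    apply: contra uS => su; apply: memv_span; rewrite inS; exact/andP.
  case/allPn=> b bA; rewrite negbK.
  case/andP=> pb pc.
  have cA : val u - b \in A by case/andP: pc.
  have inspan (a : V) (aA : a \in A) : pos a -> phi a < phi (val u) ->
      a \in <<S>>%VS.
    move=> pa lt_a; apply: contrapT => /negP aS.
    have /umin /= : P (SeqSub aA) by apply/andP.
    by rewrite leNgt lt_a.
  have [_ b0] := andP pb; have [_] := andP pc; rewrite linearB /= => c0.
  case/negP: uS; rewrite -[val u](subrK b) memvD//.
    by apply: inspan cA pc _; rewrite linearB /= ltrBlDr ltrDl.
  by apply: inspan bA pb _; rewrite -subr_gt0.
have spanS : <<S>>%VS = fullv.
  apply/eqP; rewrite eqEsubv subvf /= -spanA; apply/span_subvP => v vA.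
  have [/posS //|/posS] := posVN v vA.
  by rewrite memvN.
have sizeS : (\dim {:V} <= size S)%N by rewrite -spanS dim_span.
(* A positive element of [A] makes the maximum [phi t] positive, so -t is negative and differs from
   all elements of [S]. *)
have [a aS] : exists a, a \in S.
  case: (S) (leq_trans dimV sizeS) => // a s _.
  by exists a; rewrite mem_head.
move: (aS); rewrite inS => /andP[pa _].
have aA : a \in A by case/andP: pa.
have Pa : [pred t : seq_sub A | true] (SeqSub aA) by [].
case: (arg_maxP (fun t : seq_sub A => phi (val t)) Pa) => -[t tA] _ tmax.
have {}tmax v : v \in A -> phi v <= phi t.
  by move=> vA; exact: (tmax (SeqSub vA)).
have phit : 0 < phi t by case/andP: pa => _ /lt_le_trans; apply; apply: tmax.
have posT v : v \in take (\dim {:V}) S -> simple v.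
  by move=> /mem_take; rewrite inS.
have diffS u v : simple u -> simple v -> u - v \notin A.
  (* By symmetry of [A], u - v or v - u is positive; exchanging u and v reduces to the first
     case. *)
  wlog pw : u v / pos (u - v).
    move=> wl su sv; apply/negP => wA; case: (posVN _ wA) => pw.
      by case/negP: (wl _ _ pw su sv).
    rewrite opprB in pw; case/negP: (wl _ _ pw sv su).
    by rewrite -opprB AN.
  move=> /andP[_ /allP su] /andP[pv _]; have /andP[vA _] := pv.
  by have := su _ vA; rewrite pv pw.
have diffT v : simple v -> v + t \notin A.
  move=> /andP[/andP[_ v0] _]; apply/negP => /tmax.
  by rewrite linearD /= gerDr leNgt v0.
(* [S] may have more elements than the dimension; the surplus is cut off. *)
exists (- t :: take (\dim {:V}) S); split.
- by rewrite /= size_takel.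
- rewrite /= take_uniq ?undup_uniq// andbT.
  apply/negP => /posT /andP[/andP[_]].
  by rewrite linearN /= oppr_gt0 ltNge ltW.
- move=> v; rewrite inE => /predU1P[->|/posT /andP[/andP[]//]].
  exact: AN.
- have n0 : (0 : V) \notin A.
    by apply/negP => /phiA; rewrite linear0 eqxx.
  move=> u v; rewrite !inE => /predU1P[->|/posT su] /predU1P[->|/posT sv].
  + by rewrite subrr.
  + apply/negP => /AN; rewrite opprB opprK; apply/negP; exact: diffT.
  + by rewrite opprK diffT.
  + exact: diffS.
Qed.

(** Rescale v to norm 1. Continuity bounds f on the unit ball, so the [sup] is a genuine upper
    bound. *)
Lemma dual_norm_ge (R : realType) (X : normedModType R) (f : {scalar X})
    (v : X) :
  continuous (f : X -> R) -> `|f v| <= dual_norm f * `|v|.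
Proof.
move=> /linear_bounded_continuous /bounded_funP /(_ 1)[M fM].
have [->|v0] := eqVneq v 0; first by rewrite linear0 !normr0 mulr0.
have nv0 : 0 < `|v| by rewrite normr_gt0.
rewrite -ler_pdivrMr//.
have -> : `|f v| / `|v| = `|f (`|v|^-1 *: v)|.
  by rewrite linearZ /= normrM normfV normr_id mulrC.
apply: ub_le_sup.
  by exists M => _ [w /= w1 <-]; exact: fM.
exists (`|v|^-1 *: v) => //=.
by rewrite normrZ normfV normr_id mulVf ?gt_eqF.
Qed.

Section AuerbachBasis.
Context (R : realType) (X : finDimBanachType R) (n : nat).
Context (x : 'I_n -> X) (f : 'I_n -> {scalar X}) (xf : Auerbach_basis x f).

Lemma Auerbach_coord_le i v : `|f i v| <= `|v|.
Proof.
have [_ fc _ _ f1] := xf.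
by have := dual_norm_ge v (fc i); rewrite f1 mul1r.
Qed.

Lemma Auerbach_coordE (c : 'I_n -> R) i : f i (\sum_j c j *: x j) = c i.
Proof.
have [_ _ fx _ _] := xf.
rewrite linear_sum (bigD1 i)//= linearZ /= fx eqxx mulr1 big1 ?addr0// => j ji.
by rewrite linearZ /= fx eq_sym (negPf ji) mulr0.
Qed.

Lemma Auerbach_basis_of : basis_of fullv [tuple x i | i < n].
Proof.
have [dimX _ _ _ _] := xf.
rewrite basisEfree subvf dimX size_tuple leqnn !andbT.
apply/freeP => c c0 i; rewrite -[LHS](Auerbach_coordE c).
suff -> : \sum_j c j *: x j = 0 by rewrite linear0.
by rewrite -[RHS]c0; apply: eq_bigr => j _; rewrite -tnth_nth tnth_mktuple.
Qed.

Lemma Auerbach_decomposition v : v = \sum_i f i v *: x i.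
Proof.
(* Basis coordinates exist by freeness and dimension; biorthogonality then identifies them with the
   [f i v]. *)
set c := fun i => coord [tuple x i | i < n] i v.
have vE : v = \sum_i c i *: x i.
  rewrite {1}(coord_basis Auerbach_basis_of (memvf v)).
  by apply: eq_bigr => i _; rewrite -tnth_nth tnth_mktuple.
by rewrite [LHS]vE; apply: eq_bigr => i _; rewrite vE Auerbach_coordE.
Qed.

Lemma Auerbach_int_norm_ge1 v :
  (forall i, f i v \is a Num.int) -> v != 0 -> 1 <= `|v|.
Proof.
move=> vint v0.
have [i fi0] : exists i, f i v != 0.
  apply/existsP; apply: contra_neqT v0 => /existsPn f0.
  rewrite [v]Auerbach_decomposition big1// => i _.
  by rewrite (eqP (negbNE (f0 i))) scale0r.
exact: le_trans (norm_intr_ge1 (vint i) fi0) (Auerbach_coord_le i v).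
Qed.

Lemma Auerbach_int_norm_le1 v i :
  (forall i, f i v \is a Num.int) -> `|v| <= 1 -> f i v \in [:: 0; 1; -1].
Proof.
move=> vint v1; have fi1 := le_trans (Auerbach_coord_le i v) v1.
have [->|fi0] := eqVneq (f i v) 0; first by rewrite mem_head.
have /eqP : `|f i v| = 1.
  by apply/le_anti; rewrite fi1 norm_intr_ge1.
by rewrite eqr_norml ler01 andbT !inE => ->; rewrite orbT.
Qed.

End AuerbachBasis.

Unset Implicit Arguments.
Set Strict Implicit.

Theorem theorem2 (R : realType) (X : finDimBanachType R) (n : nat)
    (n_ge1 : (1 <= n)%N) (dimX : \dim {:X} = n)
    (x : 'I_n -> X) (f : 'I_n -> {scalar X}) (xf : Auerbach_basis x f) :
  exists z : 'I_n.+1 -> X,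
    [/\ forall k, exists c : 'I_n -> R,
          (forall i, c i \in [:: 0; 1; -1]) /\ z k = \sum_(i < n) c i *: x i,
        forall k, `|z k| = 1
      & forall k l : 'I_n.+1, (k < l)%N -> 1 < `|z k - z l|].
Proof.
have [_ _ fx x1 _] := xf.
(* The values 0, 1, 2 of g encode the coefficients -1, 0, 1. *)
pose V (g : {ffun 'I_n -> 'I_3}) : X := \sum_i ((g i)%:R - 1) *: x i.
pose A : seq X :=
  [seq v <- [seq V g | g <- enum {ffun 'I_n -> 'I_3}] | `|v| == 1].
(* Integrality of coordinates, unlike membership in {0, 1, -1}, passes to differences; norm 1
   restores the restriction. *)
have AP v : reflect ((forall i, f i v \is a Num.int) /\ `|v| = 1) (v \in A).
  rewrite mem_filter; apply: (iffP andP) => [[/eqP v1 /mapP[g _ vE]]|[vint v1]].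
    split=> // i; rewrite vE (Auerbach_coordE xf).
    by rewrite rpredB ?rpred1 ?intr_nat.
  split; first exact/eqP.
  pose h (c : R) : 'I_3 := if c == 0 then 1 else if c == 1 then 2 else 0.
  apply/mapP; exists [ffun i => h (f i v)]; first exact: mem_enum.
  rewrite [LHS](Auerbach_decomposition xf); apply: eq_bigr => i _.
  congr (_ *: _); rewrite ffunE.
  have v1' : `|v| <= 1 by rewrite v1.
  have := Auerbach_int_norm_le1 xf i vint v1'.
  rewrite !inE /h => /or3P[] /eqP ->;
    rewrite ?eqxx ?oner_eq0 ?oppr_eq0 ?oner_eq0.
  - by rewrite subrr.
  - by rewrite addrK.
  - by rewrite (_ : (-1 == 1 :> R) = false) ?sub0r//; apply/eqP; lra.
pose phi_fun (v : X) : R := \sum_(i < n) 3 ^+ i * f i v.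
have phi_lin : scalar phi_fun.
  move=> a u v; rewrite /phi_fun mulr_sumr -big_split /=.
  by apply: eq_bigr => i _; rewrite linearP /= mulrDr mulrCA.
pose phiL := GRing.isLinear.Build R X R *%R phi_fun phi_lin.
pose phi : {scalar X} := HB.pack phi_fun phiL.
have AN : {in A, forall v, - v \in A}.
  move=> v /AP[vint v1]; apply/AP; split; last by rewrite normrN.
  by move=> i; rewrite linearN /= rpredN.
have phiA : {in A, forall v, phi v != 0}.
  move=> v /AP[vint v1]; apply/eqP => phi0.
  (* Coordinates extended by 0 to all naturals, as the ternary lemma expects. *)
  pose c i := if insub i is Some j then f j v else 0 : R.
  have cE (i : 'I_n) : c i = f i v by rewrite /c valK.
  have c0 : forall i, (i < n)%N -> c i = 0.
    apply: ternary_sum_eq0 => [i lt_in|].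
      rewrite (cE (Ordinal lt_in)); apply: (Auerbach_int_norm_le1 xf) => //.
      by rewrite v1.
    by rewrite -[RHS]phi0; apply: eq_bigr => i _; rewrite cE.
  suff v0 : v = 0 by move/eqP: v1; rewrite v0 normr0 eq_sym oner_eq0.
  rewrite [v](Auerbach_decomposition xf) big1// => i _.
  by rewrite -cE c0// scale0r.
have spanA : <<A>>%VS = fullv.
  apply/eqP; rewrite eqEsubv subvf /= -(span_basis (Auerbach_basis_of xf)).
  apply/span_subvP => _ /mapP[i _ ->]; apply/memv_span/AP; split=> // j.
  by rewrite fx intr_nat.
have [|s [szs us sA sdiff]] := exists_difference_free AN phiA spanA.
  by rewrite dimX.
rewrite dimX in szs.
have zA (k : 'I_n.+1) : s`_k \in A by rewrite sA// mem_nth// szs.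
exists (fun k => s`_k); split=> [k|k|k l lt_kl].
- have /AP[zint z1] := zA k.
  exists (fun i => f i s`_k); split; last exact: Auerbach_decomposition xf _.
  by move=> i; apply: (Auerbach_int_norm_le1 xf) => //; rewrite z1.
- by have /AP[] := zA k.
- have dint i : f i (s`_k - s`_l) \is a Num.int.
    have /AP[kint _] := zA k; have /AP[lint _] := zA l.
    by rewrite linearB /= rpredB.
  have d0 : s`_k - s`_l != 0.
    by rewrite subr_eq0 nth_uniq ?szs// ltn_eqF.
  (* The difference is nonzero and integral, so its norm is at least 1; equality would put it in
     [A]. *)
  rewrite lt_neqAle (Auerbach_int_norm_ge1 xf)// andbT.
  have /negP dA : s`_k - s`_l \notin A by rewrite sdiff// mem_nth// szs.
  by apply/eqP => d1; apply: dA; apply/AP.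
Qed.
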